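(* Let $R$ be a commutative ring such that every pure-essential extension of $R$-modules is essential. Then for every maximal ideal $P$ of $R$, the localization $R_P$ is a pure-semisimple ring.
   Context: A submodule is pure if the inclusion remains injective after tensoring with every module. An extension $A\subseteq B$ is pure-essential if $A$ is pure in $B$ and for every submodule $K$ of $B$, either $K\cap A\neq0$ or $(A+K)/K$ is not pure in $B/K$. A ring is pure-semisimple if every module over it is pure-injective (injective relative to pure exact sequences).
   Formalization: In the definition of pure-essential, K ranges over nonzero submodules only: with K = 0 allowed no extension is pure-essential and the claim fails for R = Z, P = (p). Equality, units and ideal membership are taken as decidable, which excluded middle and choice supply. *)

(* Defs.v *)
From HB Require Import structures.
From mathcomp Require Import all_boot all_algebra.
Set Implicit Arguments. Unset Strict Implicit. Unset Printing Implicit Defensive.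
Import GRing.Theory.
Local Open Scope ring_scope.

(* ---------- Tensor products M (x)_R N, presented honestly as the free
   abelian group on M x N modulo the bilinearity/balancing relations.
   A formal Z-combination  sum_i k_i [m_i, n_i]  is a list of pairs
   (k_i, (m_i, n_i)); it represents 0 in M (x)_R N iff it is an integer
   combination of the defining relations. ---------- *)
Section Tensor.
Variables (R : comNzRingType) (M N : lmodType R).

Definition fcoef (s : seq (int * (M * N))) (p : M * N) : int :=
  \sum_(x <- s | x.2 == p) x.1.

Definition tensor_gen (s : seq (int * (M * N))) : Prop :=
  (exists (m m' : M) (n : N),
      s = [:: (1%:Z, (m + m', n)); (-1, (m, n)); (-1, (m', n))]) \/
  (exists (m : M) (n n' : N),
      s = [:: (1%:Z, (m, n + n')); (-1, (m, n)); (-1, (m, n'))]) \/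
  (exists (r : R) (m : M) (n : N),
      s = [:: (1%:Z, (r *: m, n)); (-1, (m, r *: n))]).

Definition tensor_zero (s : seq (int * (M * N))) : Prop :=
  exists rs : seq (int * seq (int * (M * N))),
    (forall x, x \in rs -> tensor_gen x.2) /\
    (forall p, fcoef s p = \sum_(x <- rs) x.1 * fcoef x.2 p).
End Tensor.

Section Purity.
Variable R : comNzRingType.

Definition pure (A B : lmodType R) (f : A -> B) : Prop :=
  injective f /\
  forall (M : lmodType R) (s : seq (int * (M * A))),
    tensor_zero (map (fun x => (x.1, (x.2.1, f x.2.2))) s) -> tensor_zero s.

Definition surj (A B : Type) (g : A -> B) : Prop := forall b, exists a, g a = b.

(* Submodules K of B are represented by the quotient maps g : B ->> B/K;
   K <> 0 iff g is not injective, K /\ A <> 0 iff g \o f is not injective,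
   and (A+K)/K  in  B/K  is the image of g \o f. *)
Definition essential (A B : lmodType R) (f : {linear A -> B}) : Prop :=
  injective f /\
  forall (C : lmodType R) (g : {linear B -> C}),
    surj g -> ~ injective g -> ~ injective (g \o f).

Definition pure_essential (A B : lmodType R) (f : {linear A -> B}) : Prop :=
  pure f /\
  forall (C : lmodType R) (g : {linear B -> C}),
    surj g -> ~ injective g -> ~ injective (g \o f) \/ ~ pure (g \o f).

Definition is_ideal (I : {pred R}) : Prop :=
  0 \in I /\ (forall x y, x \in I -> y \in I -> x + y \in I) /\
  (forall r x, x \in I -> r * x \in I).

Definition maximal_ideal (P : {pred R}) : Prop :=
  is_ideal P /\ 1 \notin P /\
  forall Q : {pred R}, is_ideal Q -> {subset P <= Q} -> (1 \in Q) \/ Q =i P.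

Definition is_localization (P : {pred R}) (L : comUnitRingType)
    (phi : {rmorphism R -> L}) : Prop :=
  (forall s, s \notin P -> phi s \is a GRing.unit) /\
  (forall x : L, exists r s, s \notin P /\ x = phi r / phi s) /\
  (forall r, phi r = 0 -> exists s, s \notin P /\ s * r = 0).
End Purity.

Definition pure_injective (L : comNzRingType) (M : lmodType L) : Prop :=
  forall (A B : lmodType L) (f : {linear A -> B}), pure f ->
  forall h : {linear A -> M}, exists h' : {linear B -> M}, h' \o f =1 h.

Definition pure_semisimple (L : comNzRingType) : Prop :=
  forall M : lmodType L, pure_injective M.

(* Main.v *)
Require Import Defs.
From HB Require Import structures.
From mathcomp Require Import all_boot all_algebra ring.
From mathcomp Require Import boolp classical_sets functions.

(* Purity is equivalent to solvability in the submodule of every finite linear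
   system over it that is solvable in the extension. By Zorn's lemma, a pure
   f : A -> D over L = R_P has a quotient g : D -> C with g \o f pure and
   pure-essential, also over R (denominators can be cleared), hence essential by
   hypothesis.
   Let m be the maximal ideal of L. If some module U had elements b_n killed by
   m and pp formulas phi_n with b_i in phi_n(U) for n <= i but b_n not in
   phi_(n+1)(U), apply this to A = the finitely supported sequences inside
   D = U^nat: by purity the image of the sequence b in C lies outside A, and it
   is killed by m, so it spans a simple submodule meeting A trivially, which
   contradicts essentiality. Two choices of (U, b, phi) show that
   - m is T-nilpotent: if r_n = q_0 ... q_(n-1) never vanishes, take
     U = (+)_i L/(r_i m), b_n = r_n, phi_n = "r_n divides v";
   - dim m/m^2 <= 1: if x, y are independent modulo m^2, take
     U = L[T]/((y - xT) + m^2[T]), b_n = y T^n, phi_n(v) = "v = y z_0,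
     x z_0 = y z_1, ..., x z_(n-1) = y z_n for some z".
   Hence m = (x) with x nilpotent, and then a pure essential extension is an
   equality. Applied to the pushout of a pure A -> B along h : A -> M, this
   extends h to B. *)

Set Implicit Arguments. Unset Strict Implicit. Unset Printing Implicit Defensive.
Import GRing.Theory.
Local Open Scope ring_scope.

(** * Submodules and quotients cut out by a closed predicate *)

Section SubAndQuotient.
Local Open Scope quotient_scope.
Variables (R : comNzRingType) (V : lmodType R) (K : V -> Prop).
Hypotheses (K0 : K 0) (KD : forall u v, K u -> K v -> K (u + v))
  (KZ : forall r u, K u -> K (r *: u)).

Let S : {pred V} := fun v => `[< K v >].

Let S_submod : submod_closed S.
Proof.
split=> [|r u v]; rewrite !unfold_in; first exact/asboolP.
by move=> /asboolP Ku /asboolP Kv; apply/asboolP/KD => //; exact: KZ.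
Qed.

HB.instance Definition _ := GRing.isSubmodClosed.Build R V S S_submod.

Local Notation T := (Quotient.quot S).
Let scale (r : R) : T -> T := lift_op1 T ( *:%R r).
Let pi_scale r : {morph \pi_T : x / r *: x >-> scale r x}.
Proof.
move=> x; unlock scale; apply/eqP; rewrite piE Quotient.equivE.
rewrite -scalerBr rpredZ //.
by have := Quotient.idealrBE S x (repr (\pi_T x)); rewrite reprK eqxx => ->.
Qed.

Let scaleA a b v : scale a (scale b v) = scale (a * b) v.
Proof. by rewrite -[v]reprK -!pi_scale scalerA. Qed.
Let scale1 : left_id 1 scale.
Proof. by move=> v; rewrite -[v]reprK -!pi_scale scale1r. Qed.
Let scaleDr : right_distributive scale +%R.
Proof.
move=> r u v; rewrite -[u]reprK -[v]reprK -!raddfD -!pi_scale -raddfD.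
by rewrite scalerDr.
Qed.
Let scaleDl v : {morph scale^~ v : a b / a + b}.
Proof. by move=> a b; rewrite -[v]reprK -!pi_scale scalerDl raddfD. Qed.
HB.instance Definition _ :=
  GRing.Zmodule_isLmodule.Build R T scaleA scale1 scaleDr scaleDl.
Let pi_linear : linear \pi_T.
Proof. by move=> r u v; rewrite raddfD /= pi_scale. Qed.
HB.instance Definition _ := GRing.isLinear.Build R V T *:%R \pi_T pi_linear.

Lemma quotient_exists : exists (Q : lmodType R) (p : {linear V -> Q}),
  Defs.surj p /\ forall v, p v = 0 <-> K v.
Proof.
exists T, (\pi_T : {linear V -> T}); split=> [q|v].
  by exists (repr q); exact: reprK.
rewrite -(raddf0 \pi_T); split=> [/eqP|Kv].
  by rewrite -Quotient.idealrBE subr0 => /asboolP.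
by apply/eqP; rewrite -Quotient.idealrBE subr0; apply/asboolP.
Qed.

HB.instance Definition _ := [SubChoice_isSubLmodule of {v | S v} by <:].

Lemma submodule_exists : exists (U : lmodType R) (i : {linear U -> V}),
  injective i /\ forall v, K v <-> exists u, i u = v.
Proof.
exists {v | S v}, (val : {linear {v | S v} -> V}); split; first exact: val_inj.
move=> v; split=> [Kv|[[u Su] <-]]; last exact/asboolP.
by have Sv : S v by [exact/asboolP]; exists (Sub v Sv).
Qed.

End SubAndQuotient.

(** * Formal integer combinations and their evaluation *)

Section FormalSums.
Variable T : eqType.
Implicit Types (s : seq (int * T)) (rs : seq (int * seq (int * T))).

Let coef s t : int := \sum_(x <- s | x.2 == t) x.1.

Lemma formal_sum_coef (G : zmodType) (beta : T -> G) s (U : seq T) :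
  uniq U -> {subset map snd s <= U} ->
  \sum_(x <- s) beta x.2 *~ x.1 = \sum_(t <- U) beta t *~ coef s t.
Proof.
move=> uU; elim: s => [|[k t] s IHs] sU.
  by rewrite big_nil big1 // => t _; rewrite /coef big_nil mulr0z.
rewrite big_cons IHs => [|u us]; last by apply: sU; rewrite inE us orbT.
have tU : t \in U by apply: sU; rewrite inE eqxx.
rewrite (bigD1_seq t) //= [RHS](bigD1_seq t) //= addrA; congr (_ + _).
  by rewrite /coef big_cons /= eqxx mulrzDr.
by apply: eq_bigr => u; rewrite eq_sym /coef big_cons /= => /negPf->.
Qed.

(** Evaluation depends only on the coefficient functions. All lists are finite, so both sides can be
    collected over one list [U] of the points that occur. *)
Lemma formal_sum_eval (G : zmodType) (beta : T -> G) s rs :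
  (forall t, coef s t = \sum_(x <- rs) x.1 * coef x.2 t) ->
  \sum_(x <- s) beta x.2 *~ x.1 =
  \sum_(x <- rs) (\sum_(y <- x.2) beta y.2 *~ y.1) *~ x.1.
Proof.
move=> srs.
set U := undup (map snd s ++ flatten [seq map snd x.2 | x <- rs]).
have uU : uniq U by exact: undup_uniq.
rewrite (formal_sum_coef _ uU) => [|t ts]; last by rewrite mem_undup mem_cat ts.
under eq_bigr do rewrite srs mulrz_sumr.
rewrite exchange_big [LHS]big_seq [RHS]big_seq; apply: eq_bigr => x xrs.
rewrite (formal_sum_coef _ uU) => [|t tx]; last first.
  rewrite mem_undup mem_cat; apply/orP; right; apply/flattenP.
  by exists (map snd x.2) => //; apply: map_f.
by rewrite mulrz_suml; apply: eq_bigr => t _; rewrite mulrC mulrzA.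
Qed.

End FormalSums.

(** * The universal property of the tensor product *)

Section TensorVanishing.
Variables (R : comNzRingType) (M N : lmodType R).

Definition balanced (G : zmodType) (beta : M * N -> G) : Prop :=
  [/\ forall m m' n, beta (m + m', n) = beta (m, n) + beta (m', n),
      forall m n n', beta (m, n + n') = beta (m, n) + beta (m, n')
    & forall r m n, beta (r *: m, n) = beta (m, r *: n)].

Lemma tensor_gen_balanced (G : zmodType) (beta : M * N -> G) s :
  balanced beta -> tensor_gen s -> \sum_(x <- s) beta x.2 *~ x.1 = 0.
Proof.
case=> bl br bs.
case=> [[m [m' [n ->]]]|[[m [n [n' ->]]]|[r [m [n ->]]]]];
  rewrite !big_cons big_nil /= ?addr0 !mulrNz ?mulr1z ?bl ?br ?bs ?subrr //.
  by rewrite -opprD subrr.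
by rewrite -opprD subrr.
Qed.

Lemma tensor_zeroP s :
  tensor_zero s <-> forall (G : zmodType) (beta : M * N -> G),
    balanced beta -> \sum_(x <- s) beta x.2 *~ x.1 = 0.
Proof.
split=> [[rs [rsP rsE]] G beta bal|s0].
  rewrite (formal_sum_eval beta rsE) big_seq big1 // => x /rsP xgen.
  by rewrite (tensor_gen_balanced bal) ?mul0rz.
(* Writing [int^o] makes [F] a module over the integers, so that [quotient_exists] applies.
   Functions of infinite support are harmless: only the kernel [K] matters. *)
pose F := (M * N)%type -> int^o.
pose K (h : F) := exists rs : seq (int * seq (int * (M * N))),
  (forall x, x \in rs -> tensor_gen x.2) /\
  (forall p, h p = \sum_(x <- rs) x.1 * fcoef x.2 p).
have K0 : K 0 by exists [::]; split=> // p; rewrite big_nil.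
have KD u v : K u -> K v -> K (u + v).
  case=> rs [rsP rsE] [rs' [rsP' rsE']]; exists (rs ++ rs'); split=> [x|p].
    by rewrite mem_cat => /orP[/rsP|/rsP'].
  by rewrite big_cat /= -rsE -rsE'.
have KZ (r : int) u : K u -> K (r *: u).
  case=> rs [rsP rsE]; exists [seq (r * x.1, x.2) | x <- rs]; split=> [x|p].
    by case/mapP=> y /rsP yP ->.
  rewrite big_map [LHS](_ : _ = r * u p) // rsE mulr_sumr.
  by apply: eq_bigr => x _; rewrite mulrA.
have [G [pi [_ piK]]] := quotient_exists K0 KD KZ.
(* G is the tensor product itself, with pi (del (m, n)) = m (x) n. *)
pose del p : F := fun q => (p == q)%:R.
have delE t : fcoef t = \sum_(x <- t) del x.2 *~ x.1.
  apply/funext => q; rewrite /fcoef fct_sumE big_mkcond /=.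
  apply: eq_bigr => x _; rewrite -scaler_int scalrfctE /= /del.
  by rewrite intz; case: eqP => _; rewrite ?scaler0 // /GRing.scale /= mulr1.
have pidel t : tensor_gen t -> \sum_(x <- t) pi (del x.2) *~ x.1 = 0.
  move=> tg; rewrite [LHS](_ : _ = pi (fcoef t)).
    apply/piK; exists [:: (1, t)]; split=> [x|p]; first by rewrite inE => /eqP->.
    by rewrite big_seq1 mul1r.
  by rewrite delE raddf_sum; apply: eq_bigr => x _; rewrite raddfMz.
have /s0 : balanced (fun p => pi (del p)).
  split=> [m m' n|m n n'|r m n]; apply/eqP; rewrite -subr_eq0.
  - rewrite -[X in _ == X](pidel
      [:: (1%:Z, (m + m', n)); (-1, (m, n)); (-1, (m', n))]).
      by rewrite !big_cons big_nil /= addr0 !mulrNz mulr1z opprD.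
    by left; exists m, m', n.
  - rewrite -[X in _ == X](pidel
      [:: (1%:Z, (m, n + n')); (-1, (m, n)); (-1, (m, n'))]).
      by rewrite !big_cons big_nil /= addr0 !mulrNz mulr1z opprD.
    by right; left; exists m, n, n'.
  - rewrite -[X in _ == X](pidel [:: (1%:Z, (r *: m, n)); (-1, (m, r *: n))]).
      by rewrite !big_cons big_nil /= addr0 !mulrNz mulr1z.
    by right; right; exists r, m, n.
rewrite -[LHS](_ : pi (fcoef s) = _); last first.
  by rewrite delE raddf_sum; apply: eq_bigr => x _; rewrite raddfMz.
by move/piK.
Qed.

End TensorVanishing.

(** * Purity as solvability of finite linear systems *)

Section EquationalPurity.
Variable R : comNzRingType.

Definition eq_pure (A B : lmodType R) (f : A -> B) : Prop :=
  forall m n (c : 'I_m -> 'I_n -> R) (a : 'I_m -> A) (z : 'I_n -> B),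
  (forall i, f (a i) = \sum_j c i j *: z j) ->
  exists x : 'I_n -> A, forall i, a i = \sum_j c i j *: x j.

Variables (A B : lmodType R) (f : {linear A -> B}).

(** One equation in no unknowns says that its constant term vanishes. *)
Lemma eq_pure_inj : eq_pure f -> injective f.
Proof.
move=> fp u v fuv; apply/eqP; rewrite -subr_eq0.
have [i|x /(_ ord0)] := fp 1%N 0%N (fun _ _ => 0) (fun=> u - v) (fun=> 0).
  by rewrite big_ord0 raddfB /= fuv subrr.
by rewrite big_ord0 => ->.
Qed.

(* Taking k = ([:: (1, f a)], a) forces rho (f a) = a. *)
Lemma eq_pure_transport (cs : seq (seq (R * B) * A)) : eq_pure f ->
  (forall k, k \in cs -> f k.2 = \sum_(x <- k.1) x.1 *: x.2) ->
  exists rho : B -> A,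
    forall k, k \in cs -> k.2 = \sum_(x <- k.1) x.1 *: rho x.2.
Proof.
move=> fp csP; set U := undup (flatten [seq map snd k.1 | k <- cs]).
pose c (i : 'I_(size cs)) (j : 'I_(size U)) :=
  \sum_(x <- (tnth (in_tuple cs) i).1 | x.2 == tnth (in_tuple U) j) x.1.
have regroup (V : lmodType R) (g : B -> V) i :
    \sum_j c i j *: g (tnth (in_tuple U) j) =
    \sum_(x <- (tnth (in_tuple cs) i).1) x.1 *: g x.2.
  under eq_bigr do rewrite /c scaler_suml big_mkcond.
  rewrite exchange_big [LHS]big_seq [RHS]big_seq; apply: eq_bigr => x xk.
  have xU : x.2 \in U.
    rewrite mem_undup; apply/flattenP.
    exists (map snd (tnth (in_tuple cs) i).1); last exact: map_f.
    by apply: (map_f (fun k => map snd k.1)); exact: mem_tnth.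
  have /tnthP[j xj] : x.2 \in in_tuple U by [].
  rewrite (bigD1 j) //= xj eqxx big1 ?addr0 // => j' j'j.
  rewrite (inj_eq (tuple_uniqP _ _)) ?undup_uniq //.
  by rewrite eq_sym (negPf j'j).
have [i|x xE] := fp _ _ c (fun i => (tnth (in_tuple cs) i).2)
                        (fun j => tnth (in_tuple U) j).
  by rewrite (regroup _ id) csP // mem_tnth.
(* The default 0 outside [U] is arbitrary: the constraints evaluate [rho] only on [U]. *)
exists (fun b => if insub (index b U) is Some j then x j else 0) => k kcs.
have /tnthP[i ->] : k \in in_tuple cs by [].
rewrite -(regroup _ (fun b => if insub (index b U) is Some j then x j else 0)).
rewrite xE; apply: eq_bigr => j _; congr (_ *: _).
rewrite (tnth_nth 0) /= index_uniq ?undup_uniq //.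
by rewrite valK.
Qed.

(** A certificate of vanishing over B mentions finitely many elements of B, and each relation in it
    imposes linear constraints on them. A map [rho] back to A that respects these constraints and
    inverts [f] on the entries of [s] carries the certificate over to A. *)
Lemma eq_pure_pure : eq_pure f -> pure f.
Proof.
move=> fp; split=> [|M s [rs [rsP rsE]]]; first exact: eq_pure_inj.
pose con1 (x : int * (M * A)) := ([:: (1 : R, f x.2.2)], x.2.2).
pose rho_ok (rho : B -> A) (t : seq (int * (M * B))) :=
  tensor_gen [seq (y.1, (y.2.1, rho y.2.2)) | y <- t].
have gen_con t : tensor_gen t -> exists cs : seq (seq (R * B) * A),
    (forall k, k \in cs -> f k.2 = \sum_(x <- k.1) x.1 *: x.2) /\
    forall rho, (forall k, k \in cs -> k.2 = \sum_(x <- k.1) x.1 *: rho x.2) ->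
      rho_ok rho t.
  case=> [[m [m' [b ->]]]|[[m [b [b' ->]]]|[r [m [b ->]]]]].
  - by exists [::]; split=> // rho _; left; exists m, m', (rho b).
  - exists [:: ([:: (1, b + b'); (-1, b); (-1, b')], 0)]; split=> [k|rho].
      rewrite inE => /eqP-> /=.
      by rewrite !big_cons big_nil /= raddf0 addr0 !scaleN1r scale1r -opprD subrr.
    move/(_ _ (mem_head _ _)); rewrite !big_cons big_nil /= addr0 !scaleN1r.
    rewrite scale1r -opprD => /esym/eqP; rewrite subr_eq0 => /eqP rhoD.
    by right; left; exists m, (rho b), (rho b'); rewrite -rhoD.
  - exists [:: ([:: (1, r *: b); (- r, b)], 0)]; split=> [k|rho].
      rewrite inE => /eqP-> /=.
      by rewrite !big_cons big_nil /= raddf0 addr0 scaleNr scale1r subrr.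
    move/(_ _ (mem_head _ _)); rewrite !big_cons big_nil /= addr0 scaleNr.
    rewrite scale1r => /esym/eqP; rewrite subr_eq0 => /eqP rhoZ.
    by right; right; exists r, m, (rho b); rewrite -rhoZ.
have {gen_con} [cs [csP csE]] : exists cs : seq (seq (R * B) * A),
    (forall k, k \in cs -> f k.2 = \sum_(x <- k.1) x.1 *: x.2) /\
    forall rho, (forall k, k \in cs -> k.2 = \sum_(x <- k.1) x.1 *: rho x.2) ->
      forall x, x \in rs -> rho_ok rho x.2.
  elim: rs rsP {rsE} => [|t rs IHrs] rsP; first by exists [::].
  have [|cs [csP csE]] := IHrs; first by move=> x xrs; apply: rsP; rewrite inE xrs orbT.
  have [ct [ctP ctE]] := gen_con _ (rsP _ (mem_head _ _)).
  exists (ct ++ cs); split=> [k|rho rhoP x]; first by rewrite mem_cat => /orP[/ctP|/csP].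
  rewrite inE => /orP[/eqP->|xrs].
    by apply: ctE => k kct; apply: rhoP; rewrite mem_cat kct.
  by apply: csE => // k kcs; apply: rhoP; rewrite mem_cat kcs orbT.
have [k|rho rhoP] := eq_pure_transport (cs := map con1 s ++ cs) fp.
  rewrite mem_cat => /orP[/mapP[x _ ->]|/csP//] /=.
  by rewrite big_seq1 scale1r.
have rhof x : x \in s -> rho (f x.2.2) = x.2.2.
  move=> xs; have := rhoP (con1 x); rewrite mem_cat map_f // => /(_ isT).
  by rewrite big_seq1 scale1r.
apply/tensor_zeroP => G beta bal.
rewrite [LHS](_ : _ = \sum_(x <- [seq (x.1, (x.2.1, f x.2.2)) | x <- s])
    beta (x.2.1, rho x.2.2) *~ x.1); last first.
  rewrite big_map [LHS]big_seq [RHS]big_seq; apply: eq_bigr => x xs /=.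
  by rewrite rhof //; case: x.2.
rewrite (formal_sum_eval (fun p => beta (p.1, rho p.2)) rsE).
rewrite big_seq big1 // => x xrs.
have /(tensor_gen_balanced bal) : rho_ok rho x.2.
  by apply: csE xrs => k kcs; apply: rhoP; rewrite mem_cat kcs orbT.
by rewrite big_map => ->; rewrite mul0rz.
Qed.

(** Tensor with the cokernel [M] of the matrix [c]. The quotient [Q] of A^m by the solvable
    right-hand sides is M (x) A, and the class of [a] in it is the image of the sum of the e_i (x)
    a_i. *)
Lemma pure_eq_pure : pure f -> eq_pure f.
Proof.
case=> _ fp m n c a z az.
pose col (V : lmodType R) (v : 'I_m -> V) :=
  exists x : 'I_n -> V, forall i, v i = \sum_j c i j *: x j.
have col0 V : col V 0.
  by exists (fun=> 0) => i; rewrite big1 // => j _; rewrite scaler0.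
have colD V u v : col V u -> col V v -> col V (u + v).
  case=> x xE [y yE]; exists (fun j => x j + y j) => i.
  rewrite [LHS](_ : _ = u i + v i) // xE yE -big_split /=.
  by apply: eq_bigr => j _; rewrite scalerDr.
have colZ V r u : col V u -> col V (r *: u).
  case=> x xE; exists (fun j => r *: x j) => i.
  rewrite [LHS](_ : _ = r *: u i) // xE scaler_sumr.
  by apply: eq_bigr => j _; rewrite !scalerA mulrC.
have [M [p [p_surj pK]]] := quotient_exists (col0 R^o) (@colD _) (@colZ _).
have [Q [q [_ qK]]] := quotient_exists (col0 A) (@colD _) (@colZ _).
have [sec secK] := choice p_surj.
suff /qK : q a = 0 by [].
pose e (i : 'I_m) : 'I_m -> R^o := fun k => (k == i)%:R.
pose s : seq (int * (M * A)) := [seq (1%:Z, (p (e i), a i)) | i <- enum 'I_m].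
(* This makes the map v (x) u |-> v u from M (x) A to [Q] independent of the representatives chosen
   by [sec]. *)
have balq u (v v' : 'I_m -> R^o) : p v = p v' ->
    q (fun i => v i *: u : A) = q (fun i => v' i *: u).
  move=> vv'; apply/eqP; rewrite -subr_eq0 -raddfB; apply/eqP/qK.
  have /pK[x xE] : p (v - v') = 0 by rewrite raddfB /= vv' subrr.
  exists (fun j => x j *: u) => i.
  rewrite [LHS](_ : _ = (v - v') i *: u); last by rewrite scalerBl.
  by rewrite xE scaler_suml; apply: eq_bigr => j _; rewrite -scalerA.
(* Over B the sum becomes that of the (column j of c) (x) z_j, and every column vanishes in [M]. *)
have /tensor_zeroP s0 : tensor_zero s.
  apply: fp; apply/tensor_zeroP => G beta [bl br bs].
  have b0 u : beta (0, u) = 0 by apply: (addrI (beta (0, u))); rewrite -bl !addr0.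
  have b0' u : beta (u, 0) = 0 by apply: (addrI (beta (u, 0))); rewrite -br !addr0.
  have bsuml (I : finType) (F : I -> M) u : beta (\sum_i F i, u) = \sum_i beta (F i, u).
    by elim/big_rec2: _ => // i x y _ <-; rewrite bl.
  have bsumr (I : finType) (F : I -> B) u : beta (u, \sum_i F i) = \sum_i beta (u, F i).
    by elim/big_rec2: _ => // i x y _ <-; rewrite br.
  rewrite 2!big_map big_enum /=.
  under eq_bigr do rewrite mulr1z az bsumr.
  rewrite exchange_big big1 //= => j _.
  under eq_bigr do rewrite -bs.
  rewrite -bsuml [X in beta (X, _)](_ : _ = 0) //.
  transitivity (p (\sum_i c i j *: e i)).
    by rewrite raddf_sum; apply: eq_bigr => i _; rewrite -linearZ.
  apply/pK; exists (fun j' => (j' == j)%:R) => i.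
  rewrite fct_sumE (bigD1 i) //= [RHS](bigD1 j) //= !big1.
  - by rewrite eqxx [LHS](_ : _ = c i j * (i == i)%:R + 0) // eqxx.
  - by move=> j' /negPf->; rewrite scaler0.
  - move=> i' ii'; rewrite [LHS](_ : _ = c i' j * (i == i')%:R) //.
    by rewrite eq_sym (negPf ii') mulr0.
have := s0 Q (fun x => q (fun i => sec x.1 i *: x.2)).
rewrite big_map big_enum /=.
under eq_bigr => i _ do rewrite mulr1z (balq _ _ (e i)) ?secK //.
rewrite -raddf_sum [\sum_(i < m) _](_ : _ = a); last first.
  apply/funext => i; rewrite fct_sumE (bigD1 i) //= /e eqxx scale1r big1 ?addr0 //.
  by move=> i' ii'; rewrite eq_sym (negPf ii') scale0r.
apply; split=> [v v' u|v u u'|r v u] /=.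
- rewrite (balq _ _ (sec v + sec v')); last by rewrite raddfD /= !secK.
  by rewrite -raddfD; congr (q _); apply/funext => i; rewrite [LHS]scalerDl.
- by rewrite -raddfD; congr (q _); apply/funext => i; rewrite [LHS]scalerDr.
- rewrite (balq _ _ (r *: sec v)); last by rewrite linearZ /= !secK.
  by congr (q _); apply/funext => i; rewrite scalerA mulrC.
Qed.

End EquationalPurity.

(** * Maximal submodules modulo which A stays pure *)

Section MaximalPureComplement.
Variables (L : comNzRingType) (A D : lmodType L) (f : {linear A -> D}).
Hypothesis fp : eq_pure f.

(** When [K] contains 0, this expresses purity of A -> D/K without forming the quotient. The empty
    set qualifies too, as Zorn's lemma requires for the empty chain. *)
Definition pure_modulo (K : set D) : Prop :=
  [/\ forall u v, K u -> K v -> K (u + v), forall l u, K u -> K (l *: u)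
    & forall m n (c : 'I_m -> 'I_n -> L) (a : 'I_m -> A) (z : 'I_n -> D),
        (forall i, K (f (a i) - \sum_j c i j *: z j)) ->
        exists x : 'I_n -> A, forall i, a i = \sum_j c i j *: x j].

Lemma chain_finite (F : set (set D)) (s : seq D) : total_on F subset ->
  (forall u, u \in s -> (\bigcup_(X in F) X)%classic u) ->
  s = [::] \/ exists2 X, F X & forall u, u \in s -> X u.
Proof.
move=> Ftot; elim: s => [|u s IHs] sF; first by left.
right; have [X FX Xu] := sF u (mem_head _ _).
have [|s0|[Y FY Ys]] := IHs.
- by move=> v vs; apply: sF; rewrite inE vs orbT.
- by exists X => // v; rewrite s0 inE => /eqP->.
have [XY|YX] := Ftot _ _ FX FY.
  by exists Y => // v; rewrite inE => /orP[/eqP->|/Ys//]; exact: XY.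
by exists X => // v; rewrite inE => /orP[/eqP->//|/Ys]; exact: YX.
Qed.

Lemma maximal_pure_modulo : exists K : set D,
  [/\ pure_modulo K, K 0
    & forall K', pure_modulo K' -> (K `<=` K')%classic -> (K' `<=` K)%classic].
Proof.
have [F Fgood Ftot|K [Kgood Kmax]] := @Zorn_bigcup D pure_modulo.
  split=> [u v Fu Fv|l u [X FX Xu]|m n c a z az].
  - have [w|//|[X FX Xs]] := @chain_finite F [:: u; v] Ftot.
      by rewrite !inE => /orP[] /eqP->.
    have [XD _ _] := Fgood _ FX.
    by exists X => //; apply: XD; apply: Xs; rewrite !inE eqxx ?orbT.
  - by have [_ XZ _] := Fgood _ FX; exists X => //; exact: XZ.
  - pose s := [seq f (a i) - \sum_j c i j *: z j | i <- enum 'I_m].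
    have [u /mapP[i _ ->] //|s0|[X FX Xs]] := @chain_finite F s Ftot.
      have m0 : m = 0%N.
        by have := congr1 size s0; rewrite size_map size_enum_ord.
      by exists (fun=> 0) => -[i im]; exfalso; rewrite m0 in im.
    have [_ _ Xp] := Fgood _ FX.
    by apply: (Xp _ _ _ _ z) => i; apply: Xs; apply: map_f; rewrite mem_enum.
have [KD KZ _] := Kgood.
have max K' : pure_modulo K' -> (K `<=` K')%classic -> (K' `<=` K)%classic.
  by move=> K'good KK'; apply: contrapT => K'K; apply: (Kmax K').
(* Without 0, [K] would be empty and hence lie below {0}, which is admissible because [f] is
   pure. *)
have K0 : K 0.
  apply: contrapT => nK0; case: (nK0); apply: (max [set 0]%classic) => // [|u Ku].
    split=> [u v -> ->|l u ->|m n c a z az]; rewrite ?addr0 ?scaler0 //=.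
    by apply: fp => i; apply/eqP; rewrite -subr_eq0; apply/eqP; exact: az.
  by exfalso; apply: nK0; rewrite -(scale0r u); exact: KZ.
by exists K.
Qed.

End MaximalPureComplement.

(** * Restriction of scalars along a ring morphism *)

Definition restrict (R L : comNzRingType) (phi : {rmorphism R -> L})
  (V : lmodType L) : Type := V.

Section Restriction.
Variables (R L : comNzRingType) (phi : {rmorphism R -> L}).

Section OneModule.
Variable V : lmodType L.
HB.instance Definition _ := GRing.Zmodule.on (restrict phi V).
Let scale (r : R) (v : restrict phi V) : restrict phi V := phi r *: (v : V).
Let scaleA a b v : scale a (scale b v) = scale (a * b) v.
Proof. by rewrite /scale scalerA rmorphM. Qed.
Let scale1 : left_id 1 scale.
Proof. by move=> v; rewrite /scale rmorph1 scale1r. Qed.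
Let scaleDr : right_distributive scale +%R.
Proof. by move=> r u v; exact: scalerDr. Qed.
Let scaleDl v : {morph scale^~ v : a b / a + b}.
Proof. by move=> a b; rewrite /scale rmorphD scalerDl. Qed.
HB.instance Definition _ :=
  GRing.Zmodule_isLmodule.Build R (restrict phi V) scaleA scale1 scaleDr scaleDl.
End OneModule.

Lemma restrict_scale (V : lmodType L) (r : R) (v : restrict phi V) :
  r *: v = phi r *: (v : V).
Proof. by []. Qed.

Definition restrict_map (V W : lmodType L) (g : V -> W) :
  restrict phi V -> restrict phi W := g.

Section OneMap.
Variables (V W : lmodType L) (g : {linear V -> W}).
Let restrict_linear : linear (restrict_map g).
Proof. by move=> r u v; rewrite /restrict_map !restrict_scale linearP. Qed.
HB.instance Definition _ := GRing.isLinear.Build R (restrict phi V) (restrict phi W)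
  *:%R (restrict_map g) restrict_linear.
End OneMap.

Lemma restrict_eq_pure (V W : lmodType L) (g : V -> W) :
  eq_pure g -> eq_pure (restrict_map g).
Proof. by move=> gp m n c a z az; exact: (gp m n (fun i j => phi (c i j)) a z). Qed.

End Restriction.
Arguments restrict_map [R L] phi [V W] g.

(** * The localization is local and inherits a form of the hypothesis *)

Section Localization.
Variables (R : comNzRingType) (P : {pred R}).
Hypothesis HP : maximal_ideal P.

Lemma maximal_ideal_prime s t : s \notin P -> t \notin P -> s * t \notin P.
Proof.
have [[P0 [PD PM]] [P1 Pmax]] := HP.
move=> sP tP; apply/negP => stP.
pose Q : {pred R} := fun x => `[< exists p a, p \in P /\ x = p + a * t >].
have [||/asboolP[p [a [pP e1]]]|] := Pmax Q.
- split; first by apply/asboolP; exists 0, 0; rewrite mul0r addr0.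
  split=> [x y /asboolP[p [a [pP ->]]] /asboolP[q [b [qP ->]]]|
           r x /asboolP[p [a [pP ->]]]].
    by apply/asboolP; exists (p + q), (a + b); rewrite PD // mulrDl addrACA.
  by apply/asboolP; exists (r * p), (r * a); rewrite PM // mulrDr mulrA.
- by move=> p pP; apply/asboolP; exists p, 0; rewrite mul0r addr0.
- by case/negP: sP; rewrite -[s]mulr1 e1 mulrDr mulrCA; apply: PD; exact: PM.
- move=> QP; case/negP: tP; rewrite -QP; apply/asboolP; exists 0, 1.
  by rewrite P0 add0r mul1r.
Qed.

Variables (L : comUnitRingType) (phi : {rmorphism R -> L}).
Hypothesis HL : is_localization P phi.

Lemma localization_unit s : (phi s \is a GRing.unit) = (s \notin P).
Proof.
have [[P0 [PD PM]] [P1 _]] := HP; have [phiU [phiS phiK]] := HL.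
apply/idP/idP => [/mulrV|/phiU//]; have [r [t [tP ->]]] := phiS (phi s)^-1.
move=> /(congr1 ( *%R^~ (phi t))); rewrite mul1r mulrA mulrVK ?phiU // => /eqP.
rewrite -rmorphM -subr_eq0 -rmorphB => /eqP/phiK[u [uP /eqP]].
rewrite mulrBr subr_eq0 => /eqP e; apply: contra (maximal_ideal_prime uP tP) => sP.
by rewrite -e mulrCA mulrC PM.
Qed.

Lemma common_denominator (I : finType) (l : I -> L) :
  exists w (r : I -> R), w \notin P /\ forall i, phi w * l i = phi (r i).
Proof.
have [_ [P1 _]] := HP; have [phiU [phiS _]] := HL.
suff [w [wP wE]] : exists w, w \notin P /\
    forall i, i \in enum I -> exists r, phi w * l i = phi r.
  have [i|r rE] := choice (P := fun i r => phi w * l i = phi r).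
    by apply: wE; rewrite mem_enum.
  by exists w, r.
elim: (enum I) => [|i s [w [wP wE]]]; first by exists 1.
have [r [t [tP lE]]] := phiS (l i).
exists (t * w); split=> [|j]; first exact: maximal_ideal_prime.
rewrite inE rmorphM => /orP[/eqP->|/wE[q qE]].
  exists (w * r); rewrite lE [phi t * _]mulrC -mulrA [phi r / _]mulrC.
  by rewrite mulVKr ?phiU // rmorphM.
by exists (t * q); rewrite -mulrA qE rmorphM.
Qed.

Lemma localization_local (a b : L) :
  a \isn't a GRing.unit -> b \isn't a GRing.unit -> a + b \isn't a GRing.unit.
Proof.
have [[_ [PD _]] _] := HP.
have [w [r [wP rE]]] := common_denominator (fun i : bool => if i then a else b).
have unitw l : (phi w * l \is a GRing.unit) = (l \is a GRing.unit).
  by rewrite unitrM localization_unit wP.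
rewrite -(unitw a) -(unitw b) -(unitw (a + b)) mulrDr.
rewrite (rE true) (rE false) -rmorphD !localization_unit !negbK.
exact: PD.
Qed.

Lemma common_multiplier (V : lmodType R) (K : V -> Prop) (m : nat)
    (v : 'I_m -> V) :
  (forall r u, K u -> K (r *: u)) ->
  (forall i, exists2 s, s \notin P & K (s *: v i)) ->
  exists2 s, s \notin P & forall i, K (s *: v i).
Proof.
have [_ [P1 _]] := HP.
move=> KZ vK; suff [s sP sE] : exists2 s, s \notin P &
    forall i, i \in enum 'I_m -> K (s *: v i).
  by exists s => // i; apply: sE; rewrite mem_enum.
elim: (enum 'I_m) => [|i e [s sP sE]]; first by exists 1.
have [t tP tE] := vK i.
exists (s * t) => [|j]; first exact: maximal_ideal_prime.
rewrite inE => /orP[/eqP->|/sE sj]; first by rewrite -scalerA; exact: KZ.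
by rewrite mulrC -scalerA; exact: KZ.
Qed.

Hypothesis HR : forall (A B : lmodType R) (f : {linear A -> B}),
  pure_essential f -> essential f.

(** C is D/K for a maximal [K] modulo which A stays pure. As the hypothesis lives over [R],
    pure-essentiality has to be checked against all R-quotients of C, not only the L-linear ones. *)
Lemma essential_quotient (A D : lmodType L) (f : {linear A -> D}) : eq_pure f ->
  exists (C : lmodType L) (g : {linear D -> C}), eq_pure (g \o f) /\
    forall c, c != 0 -> exists l a, l *: c = g (f a) /\ l *: c != 0.
Proof.
move=> fp; have [_ [P1 _]] := HP; have [phiU _] := HL.
have [K [[KD KZ Kp] K0 Kmax]] := maximal_pure_modulo fp.
have [C [g [g_surj gK]]] := quotient_exists K0 KD KZ.
have [sec secK] := choice g_surj.
have gfp : eq_pure (g \o f).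
  move=> m n c a z az; apply: (Kp _ _ _ _ (sec \o z)) => i.
  apply/gK; rewrite raddfB raddf_sum /= [g _]az.
  apply/eqP; rewrite subr_eq0; apply/eqP; apply: eq_bigr => j _.
  by rewrite linearZ /= secK.
exists C, g; split=> // c c0.
pose F : {linear restrict phi A -> restrict phi C} := restrict_map phi (g \o f).
have [_ gf_ess] : essential F.
  apply: HR; split=> [|E h h_surj h_ninj]; first exact/eq_pure_pure/restrict_eq_pure.
  apply/not_andP => -[hgf_inj /pure_eq_pure hgf_pure]; apply: h_ninj.
  pose H : {linear restrict phi D -> E} :=
    h \o (restrict_map phi g : {linear restrict phi D -> restrict phi C}).
  have HZ w l r (u : D) : phi w * l = phi r -> w *: H (l *: u) = r *: H u.
    move=> wl; rewrite -!linearZ; congr (H _).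
    by rewrite !restrict_scale scalerA wl.
  (* The L-saturation of the kernel of H: if h were not injective, it would
     contradict the maximality of K. *)
  pose K' (u : D) := exists2 s, s \notin P & s *: H u = 0.
  have K'pm : pure_modulo f K'.
    split=> [u v [s sP su0] [t tP tv0]|l u [s sP su0]|m n d a z az].
    - exists (s * t); first exact: maximal_ideal_prime.
      rewrite raddfD scalerDr mulrC -scalerA su0 mulrC -scalerA tv0.
      by rewrite !scaler0 addr0.
    - have [w [r [wP rE]]] := common_denominator (fun _ : unit => l).
      exists (s * w); first exact: maximal_ideal_prime.
      by rewrite -scalerA (HZ _ _ _ _ (rE tt)) scalerA mulrC -scalerA su0 scaler0.
    - have [w [r [wP rE]]] := common_denominator (fun p : 'I_m * 'I_n => d p.1 p.2).
      have [||t tP tE] := common_multiplier (K := fun x : E => x = 0)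
          (v := fun i => H (f (a i) - \sum_j d i j *: z j)).
      + by move=> q x ->; rewrite scaler0.
      + by move=> i; exact: az.
      have twP : t * w \notin P by exact: maximal_ideal_prime.
      have [i|x xE] := hgf_pure _ _ (fun i j => t * r (i, j))
          (fun i => (t * w) *: (a i : restrict phi A)) (fun j => H (z j)).
        rewrite linearZ /=; have := tE i; rewrite raddfB scalerBr => /eqP.
        rewrite subr_eq0 => /eqP /(congr1 ( *:%R w)); rewrite !scalerA mulrC => e.
        transitivity ((t * w) *: H (f (a i))) => //.
        rewrite e raddf_sum scaler_sumr; apply: eq_bigr => j _.
        by rewrite -!scalerA; congr (_ *: _); exact: HZ (rE (i, j)).
      exists x => i; rewrite -[LHS]scale1r -(mulVr (phiU _ twP)) -scalerA.
      rewrite -[RHS]scale1r -(mulVr (phiU _ twP)) -scalerA; congr (_ *: _).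
      rewrite -[LHS]/((t * w) *: (a i : restrict phi A)) xE.
      rewrite scaler_sumr; apply: eq_bigr => j _.
      by rewrite restrict_scale scalerA !rmorphM -(rE (i, j)) mulrA.
  have K'K u : h (g u) = 0 -> g u = 0.
    move=> hu0; apply/gK/(Kmax _ K'pm) => [v Kv|].
      exists 1 => //; rewrite scale1r.
      have gv0 : g v = 0 by exact/gK.
      by rewrite -[LHS]/(h (g v : restrict phi C)) gv0; exact: raddf0.
    by exists 1; rewrite ?scale1r.
  move=> x y hxy; apply/eqP; rewrite -subr_eq0; apply/eqP.
  have [u gu] := g_surj (x - y).
  by rewrite -gu; apply: K'K; rewrite gu raddfB /= hxy subrr.
(* Essentiality over [R], tested on C modulo the L-span of [c], puts a nonzero element of A into
   that span. *)
pose N (x : C) := exists l, x = l *: c.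
have [|||E [h [h_surj hN]]] := @quotient_exists _ C N.
- by exists 0; rewrite scale0r.
- by move=> _ _ [l ->] [l' ->]; exists (l + l'); rewrite scalerDl.
- by move=> r _ [l ->]; exists (r * l); rewrite scalerA.
pose h' : {linear restrict phi C -> restrict phi E} := restrict_map phi h.
have h'_ninj : ~ injective h'.
  move=> h_inj; case/eqP: c0; apply: h_inj; rewrite [RHS]raddf0.
  by apply/hN; exists 1; rewrite scale1r.
have h'F_ninj : ~ injective (h' \o F) by exact: gf_ess.
apply: contrapT => no_mult; apply: h'F_ninj => a b hab.
apply/eqP; rewrite -subr_eq0; apply/negPn/negP => ab.
have /hN[l lc] : h (g (f (a - b))) = 0.
  by rewrite !raddfB; apply/eqP; rewrite subr_eq0; apply/eqP.
apply: no_mult; exists l, (a - b); split; first by rewrite lc.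
rewrite -lc; apply: contra ab => /eqP gf0; apply/eqP.
by apply: (eq_pure_inj gfp); rewrite [RHS]raddf0.
Qed.

End Localization.

(** * Primitive positive (pp) formulas in one free variable *)

Record pp_formula (L : comNzRingType) := PPFormula {
  pp_eqs : nat;
  pp_vars : nat;
  pp_free : 'I_pp_eqs -> L;
  pp_bound : 'I_pp_eqs -> 'I_pp_vars -> L }.

Definition pp_sat (L : comNzRingType) (V : lmodType L) (phi : pp_formula L)
    (v : V) : Prop :=
  exists z : 'I_(pp_vars phi) -> V,
    forall i, pp_free i *: v = \sum_j pp_bound i j *: z j.

Section PPFormulas.
Variables (L : comNzRingType) (V W : lmodType L) (phi : pp_formula L).

Lemma pp_sat_linear (g : {linear V -> W}) v : pp_sat phi v -> pp_sat phi (g v).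
Proof.
case=> z vz; exists (g \o z) => i; rewrite -linearZ vz raddf_sum.
by apply: eq_bigr => j _; exact: linearZ.
Qed.

Lemma pp_sat_pure (g : {linear V -> W}) v :
  eq_pure g -> pp_sat phi (g v) -> pp_sat phi v.
Proof.
move=> gp [z gvz]; have [i|x xE] := gp _ _ (@pp_bound _ phi)
  (fun i => pp_free i *: v) z; first by rewrite linearZ -gvz.
by exists x.
Qed.

Lemma pp_sat_fun (I : Type) (b : I -> V) :
  (forall i, pp_sat phi (b i)) -> pp_sat phi b.
Proof.
move=> /choice[z bz]; exists (fun j i => z i j) => e; apply/funext => i.
by rewrite fct_sumE [LHS]bz.
Qed.

Lemma pp_sat0 : pp_sat phi (0 : V).
Proof.
by exists (fun=> 0) => i; rewrite scaler0 big1 // => j _; rewrite scaler0.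
Qed.

End PPFormulas.

(** * Finitely supported sequences inside all sequences *)

Section FinitelySupported.
Variables (L : comNzRingType) (U : lmodType L).

Definition finitely_supported (v : nat -> U) : Prop :=
  exists N, forall i, (N <= i)%N -> v i = 0.

(** A solution among all sequences can be cut off at a common bound [M] for the supports of the
    constants: beyond it the equations read 0 = 0. *)
Lemma finitely_supported_pure : exists (A : lmodType L)
  (f : {linear A -> (nat -> U)}), eq_pure f /\
  forall v, finitely_supported v <-> exists a, f a = v.
Proof.
have [|u v [N uN] [N' vN]|r u [N uN]|A [f [f_inj fK]]] :=
    @submodule_exists L (nat -> U) finitely_supported.
- by exists 0%N.
- exists (maxn N N') => i; rewrite geq_max => /andP[Ni N'i].
  by rewrite [LHS](_ : _ = u i + v i) // uN ?vN ?addr0.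
- by exists N => i Ni; rewrite [LHS](_ : _ = r *: u i) // uN ?scaler0.
exists A, f; split=> // m n c a z az.
have /choice[N aN] i : finitely_supported (f (a i)) by apply/fK; exists (a i).
pose M := \max_i N i.
have /choice[x xE] j : exists x, f x = fun k => if (k < M)%N then z j k else 0.
  by apply/fK; exists M => i; rewrite leqNgt => /negPf->.
have fcx i j k : f (c i j *: x j) k = c i j *: f (x j) k.
  by have -> : f (c i j *: x j) = c i j *: f (x j) by exact: linearZ.
exists x => i; apply: f_inj; rewrite raddf_sum; apply/funext => k.
rewrite fct_sumE; case: (ltnP k M) => kM.
  rewrite az fct_sumE; apply: eq_bigr => j _.
  by apply/esym; rewrite [LHS]fcx xE kM.
rewrite aN ?big1 // => [j _|]; last by apply: leq_trans kM; exact: leq_bigmax.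
by rewrite [LHS]fcx xE ltnNge kM scaler0.
Qed.

End FinitelySupported.

(** This is all that the study of the local ring retains of the hypothesis on [R]; the second clause
    is essentiality in elementwise form. *)
Definition essential_quotients (L : comUnitRingType) : Prop :=
  forall (A D : lmodType L) (f : {linear A -> D}), eq_pure f ->
  exists (C : lmodType L) (g : {linear D -> C}), eq_pure (g \o f) /\
    forall c, c != 0 -> exists l a, l *: c = g (f a) /\ l *: c != 0.

(** * Descending pp chains and T-nilpotency *)

Section LocalRing.
Variable L : comUnitRingType.
Hypothesis L_local : forall a b : L,
  a \isn't a GRing.unit -> b \isn't a GRing.unit -> a + b \isn't a GRing.unit.
Hypothesis L_ess : essential_quotients L.

Lemma no_descending_pp_chain (U : lmodType L) (b : nat -> U)
    (phi : nat -> pp_formula L) :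
  (forall l n, l \isn't a GRing.unit -> l *: b n = 0) ->
  (forall n i, (n <= i)%N -> pp_sat (phi n) (b i)) ->
  ~ forall n, ~ pp_sat (phi n.+1) (b n).
Proof.
move=> b_soc b_sat b_nsat.
have [A [f [f_pure fS]]] := finitely_supported_pure U.
have [C [g [gf_pure gf_ess]]] := L_ess f_pure.
(* If g b = g (f a) with f a zero from index m on, let f h agree with b up to index m and vanish
   beyond. Then b - f h satisfies [phi m.+1] componentwise, hence by purity so does a - h. The
   component of f (a - h) at m is - b m, whence the sign in [ev]. *)
have gb_nim a : g b <> g (f a).
  move=> gba; have /fS[m am] : exists a', f a' = f a by exists a.
  have /fS[h hE] : finitely_supported (fun i => if (i < m.+1)%N then b i else 0).
    by exists m.+1 => i; rewrite leqNgt => /negPf->.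
  have : pp_sat (phi m.+1) (b - f h).
    apply: pp_sat_fun => i; rewrite [b - f h](_ : _ = fun i => b i - f h i) // hE.
    case: (ltnP i m.+1) => im; first by rewrite subrr; exact: pp_sat0.
    by rewrite subr0; exact: b_sat.
  move/(pp_sat_linear g); rewrite raddfB /= gba -raddfB -raddfB.
  move/(pp_sat_pure (g := g \o f) gf_pure)/(pp_sat_linear f).
  pose ev : (nat -> U) -> U := fun v => - v m.
  have ev_lin : linear ev.
    by move=> r u v; rewrite /ev [X in - X](_ : _ = r *: u m + v m) // opprD scalerN.
  pose evL := GRing.isLinear.Build L (nat -> U) U *:%R ev ev_lin.
  pose e : {linear (nat -> U) -> U} := HB.pack ev evL.
  move/(pp_sat_linear e); rewrite [e _](_ : _ = b m); first exact: b_nsat.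
  rewrite /e /= /ev raddfB [X in - X](_ : _ = f a m - f h m) //.
  by rewrite am // hE ltnSn sub0r opprK.
have gb0 : g b != 0.
  by apply/eqP => gb0; apply: (gb_nim 0); rewrite gb0 !raddf0.
have [l [a [lga l0]]] := gf_ess _ gb0.
(* A unit multiplier would put g b into A; a nonunit one annihilates every b n. *)
have [lU|lnU] := boolP (l \is a GRing.unit).
  apply: (gb_nim (l^-1 *: a)); rewrite !linearZ /= -lga.
  by rewrite scalerA mulVr // scale1r.
case/eqP: l0; rewrite -linearZ [X in g X](_ : _ = 0) ?raddf0 //.
by apply/funext => n; exact: b_soc.
Qed.

Lemma nonunitM (a b : L) : a \isn't a GRing.unit -> a * b \isn't a GRing.unit.
Proof. by move=> aU; rewrite unitrM (negPf aU). Qed.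

Lemma unit_1B (a : L) : a \isn't a GRing.unit -> 1 - a \is a GRing.unit.
Proof.
by move=> aU; apply/negPn/negP => /(L_local aU); rewrite addrC subrK unitr1.
Qed.

Lemma T_nilpotent (q : nat -> L) : (forall n, q n \isn't a GRing.unit) ->
  exists n, \prod_(i < n) q i = 0.
Proof.
move=> qN; apply: contrapT => /forallNP q_neq0.
pose r n := \prod_(i < n) q i.
have r_dvd n i : (n <= i)%N -> exists t, r i = r n * t.
  move=> /subnKC <-; elim: (i - n)%N => [|k [t tE]].
    by exists 1; rewrite addn0 mulr1.
  by exists (t * q (n + k)%N); rewrite addnS /r big_ord_recr /= -/(r _) tE mulrA.
pose N (p : {poly L}) := forall i, exists2 u, u \isn't a GRing.unit & p`_i = r i * u.
have [|u v uN vN i|a u uN i|U [p [p_surj pK]]] := @quotient_exists L {poly L} N.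
- by move=> i; exists 0; rewrite ?unitr0 // coef0 mulr0.
- have [x xU xE] := uN i; have [y yU yE] := vN i.
  by exists (x + y); [exact: L_local | rewrite coefD xE yE mulrDr].
- have [x xU xE] := uN i.
  by exists (a * x); [rewrite mulrC; exact: nonunitM | rewrite coefZ xE mulrCA].
pose b n := p (r n *: 'X^n).
apply: (@no_descending_pp_chain U b
  (fun n => @PPFormula L 1 1 (fun=> 1) (fun _ _ => r n))) => [l n lU|n i ni|n].
- rewrite /b -linearZ; apply/pK => i; rewrite !coefZ coefXn.
  have [->|_] := eqVneq i n; last by exists 0; rewrite ?unitr0 ?mulr0.
  by exists l; rewrite ?mulr1 1?mulrC.
- have [t tE] := r_dvd _ _ ni.
  exists (fun=> p (t *: 'X^i)) => e /=; rewrite scale1r big_ord1 /b tE -linearZ.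
  by rewrite scalerA.
(* If r_(n+1) divided b_n, the coefficients of degree n would give r_n (1 - (q_n w_n + u)) = 0 with
   [u] a nonunit. The second factor is a unit, so r_n = 0. *)
case=> z /(_ ord0) /=; rewrite scale1r big_ord1; have [w <-] := p_surj (z ord0).
rewrite /b -linearZ => /eqP; rewrite -subr_eq0 -raddfB => /eqP/pK/(_ n)[u uU].
rewrite coefB !coefZ coefXn eqxx mulr1 /r big_ord_recr /= -/(r n) -mulrA => /eqP.
rewrite -subr_eq0 -{1}[r n]mulr1 -!mulrBr -addrA -opprD => /eqP e.
have eU : 1 - (q n * w`_n + u) \is a GRing.unit.
  by apply: unit_1B; apply: L_local => //; exact: nonunitM.
by apply: (q_neq0 n); apply: (mulIr eU); rewrite e mul0r.
Qed.

End LocalRing.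

(** * The pp formulas for the bound on m/m^2 *)

Section ZigZag.
Variables (L : comNzRingType) (x y : L).

(** Row 0 reads v = y z_0, and row i > 0 reads 0 = y z_i - x z_(i-1). *)
Definition zigzag n : pp_formula L :=
  @PPFormula L n.+1 n.+1 (fun i => (val i == 0%N)%:R)
    (fun i j => y * (val j == val i)%:R - x * (j.+1 == val i)%:R).

Lemma zigzagP (V : lmodType L) n (v : V) : pp_sat (zigzag n) v <->
  exists z : nat -> V, v = y *: z 0%N /\
    forall l, (l < n)%N -> y *: z l.+1 = x *: z l.
Proof.
have pick k (z : nat -> V) : (k <= n)%N ->
    \sum_(j < n.+1) (val j == k)%:R *: z j = z k.
  move=> kn; rewrite (bigD1 (Ordinal (kn : (k < n.+1)%N))) //= eqxx scale1r.
  rewrite big1 ?addr0 // => j; rewrite -val_eqE /= => /negPf->.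
  by rewrite scale0r.
have row0 (z : nat -> V) :
    \sum_(j < n.+1) (y * (val j == 0%N)%:R - x * (j.+1 == 0%N)%:R) *: z j = y *: z 0%N.
  rewrite -[in RHS](pick 0%N) // scaler_sumr; apply: eq_bigr => j _.
  by rewrite mulr0 subr0 scalerA.
have rowS l (z : nat -> V) : (l < n)%N ->
    \sum_(j < n.+1) (y * (val j == l.+1)%:R - x * (j.+1 == l.+1)%:R) *: z j =
    y *: z l.+1 - x *: z l.
  move=> ln; rewrite -[in RHS](pick l.+1) // -[in X in _ - X](pick l) 1?ltnW //.
  rewrite !scaler_sumr -sumrB; apply: eq_bigr => j _.
  by rewrite scalerBl !scalerA eqSS.
split=> [[z vz]|[z [v0 vS]]].
  exists (fun k => z (inord k)).
  have zE (i : 'I_n.+1) : (val i == 0%N)%:R *: v = \sum_(j < n.+1)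
      (y * (val j == val i)%:R - x * (j.+1 == val i)%:R) *: z (inord j).
    by rewrite [LHS](vz i); apply: eq_bigr => j _; rewrite inord_val.
  split; first by rewrite -(row0 (fun k => z (inord k))) -(zE ord0) scale1r.
  move=> l ln; apply/eqP; rewrite -subr_eq0 -(rowS l (fun k => z (inord k))) //.
  by rewrite -(zE (Ordinal (ln : (l.+1 < n.+1)%N))) scale0r.
exists (fun j => z (val j)) => -[[|l] ln] /=; first by rewrite row0 scale1r v0.
by rewrite rowS // vS // subrr scale0r.
Qed.

End ZigZag.

(** * The maximal ideal has a nilpotent generator; pure-semisimplicity *)

Section MaximalIdeal.
Variable L : comUnitRingType.
Hypothesis L_local : forall a b : L,
  a \isn't a GRing.unit -> b \isn't a GRing.unit -> a + b \isn't a GRing.unit.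
Hypothesis L_ess : essential_quotients L.

(** This is m^2, with finite sums of products built term by term to allow induction. *)
Inductive nonunit_sq : L -> Prop :=
| NonunitSq0 : nonunit_sq 0
| NonunitSqD u v z : u \isn't a GRing.unit -> v \isn't a GRing.unit ->
    nonunit_sq z -> nonunit_sq (u * v + z).

Lemma nonunit_sqD a b : nonunit_sq a -> nonunit_sq b -> nonunit_sq (a + b).
Proof.
move=> + sb; elim=> [|u v z uU vU _ IHz]; first by rewrite add0r.
by rewrite -addrA; constructor.
Qed.

Lemma nonunit_sqM a b : nonunit_sq b -> nonunit_sq (a * b).
Proof.
elim=> [|u v z uU vU _ IHz]; first by rewrite mulr0; constructor.
rewrite mulrDr mulrA; constructor=> //.
by rewrite mulrC; exact: nonunitM.
Qed.

Lemma nonunit_sq_mul u v : u \isn't a GRing.unit -> v \isn't a GRing.unit ->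
  nonunit_sq (u * v).
Proof.
move=> uU vU; rewrite -[u * v]addr0.
by apply: NonunitSqD => //; exact: NonunitSq0.
Qed.

Lemma nonunitB (a b : L) :
  a \isn't a GRing.unit -> b \isn't a GRing.unit -> a - b \isn't a GRing.unit.
Proof. by move=> aU bU; apply: L_local; rewrite ?unitrN. Qed.

Lemma dependent_mod_sq (x y : L) :
  x \isn't a GRing.unit -> y \isn't a GRing.unit ->
  ~ forall s t, nonunit_sq (s * x + t * y) ->
      s \isn't a GRing.unit /\ t \isn't a GRing.unit.
Proof.
move=> xU yU indep.
pose N (g : {poly L}) := exists c : {poly L},
  forall i, nonunit_sq (g - (y *: c - x *: (c * 'X)))`_i.
have [|u v [c uc] [d vd]|a u [c uc]|U [p [p_surj pK]]] :=
    @quotient_exists L {poly L} N.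
- exists 0 => i; rewrite mul0r !scaler0 !subr0 coef0; exact: NonunitSq0.
- exists (c + d) => i; rewrite [X in nonunit_sq X](_ : _ =
    (u - (y *: c - x *: (c * 'X)))`_i + (v - (y *: d - x *: (d * 'X)))`_i).
    exact: nonunit_sqD.
  by rewrite !(coefN, coefD, coefZ, coefMX); case: ifP => _; ring.
- exists (a *: c) => i; rewrite [X in nonunit_sq X](_ : _ =
    a * (u - (y *: c - x *: (c * 'X)))`_i); first exact: nonunit_sqM.
  by rewrite !(coefN, coefD, coefZ, coefMX); case: ifP => _; ring.
have coef_rel (g : {poly L}) : p g = 0 -> exists c : {poly L},
    forall i, nonunit_sq (g`_i - y * c`_i + x * (c * 'X)`_i).
  case/pK => c gc; exists c => i; have := gc i.
  by rewrite !(coefB, coefZ) opprB addrA addrAC.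
pose b n := p (y *: 'X^n).
apply: (@no_descending_pp_chain L L_ess U b (zigzag x y)).
- move=> l n lU; rewrite /b -linearZ; apply/pK; exists 0 => i.
  rewrite mul0r !scaler0 !subr0 !coefZ coefXn mulrA mulrC.
  exact/nonunit_sqM/nonunit_sq_mul.
(* With T = ['X], y acts on [U] as xT. Hence z_l = T^(j-l) satisfies x z_l = y z_(l+1) as long as l
   < j. *)
- move=> n j nj; apply/zigzagP; exists (fun l => p 'X^(j - l)).
  rewrite subn0 /b linearZ; split=> // l ln; apply/eqP.
  rewrite -!linearZ -subr_eq0 -raddfB; apply/eqP/pK; exists 'X^(j - l.+1) => i.
  rewrite -exprSr subnSK ?(leq_trans ln) // subrr coef0; exact: NonunitSq0.
move=> m /zigzagP[z [z0 zS]].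
have [Z ZE] := choice (fun l => p_surj (z l)).
(* Modulo m^2, y Z_(l+1) - x Z_l = (y - xT) c for some [c]. Independence forces c T = Z_l and c =
   Z_(l+1) modulo m, so Z_l = T Z_(l+1) there. *)
have step l : (l < m.+1)%N -> (Z l)`_0 \isn't a GRing.unit /\
    forall i, (Z l.+1)`_i - (Z l)`_i.+1 \isn't a GRing.unit.
  move=> /zS; rewrite -!ZE -!linearZ => /eqP; rewrite -subr_eq0 -raddfB.
  move=> /eqP/coef_rel[c cE].
  have {}cE i : (c * 'X)`_i - (Z l)`_i \isn't a GRing.unit /\
      (Z l.+1)`_i - c`_i \isn't a GRing.unit.
    apply: indep; rewrite [X in nonunit_sq X](_ : _ =
      (y *: Z l.+1 - x *: Z l)`_i - y * c`_i + x * (c * 'X)`_i) //.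
    by rewrite coefB !coefZ; ring.
  split=> [|i].
    by have [+ _] := cE 0%N; rewrite coefMX sub0r unitrN.
  have [+ _] := cE i.+1; rewrite coefMX /= => c1; have [_ c2] := cE i.
  by rewrite -(subrKA c`_i); exact: L_local.
(* Likewise y T^m - y Z_0 = (y - xT) c gives c T = 0 and T^m - Z_0 = c modulo m. *)
have start i : (Z 0%N)`_i - (i == m)%:R \isn't a GRing.unit.
  move: z0; rewrite -ZE /b -linearZ => /eqP; rewrite -subr_eq0 -raddfB.
  move=> /eqP/coef_rel[c cE].
  have {}cE k : (c * 'X)`_k \isn't a GRing.unit /\
      (k == m)%:R - (Z 0%N)`_k - c`_k \isn't a GRing.unit.
    apply: indep; rewrite [X in nonunit_sq X](_ : _ =
      (y *: 'X^m - y *: Z 0%N)`_k - y * c`_k + x * (c * 'X)`_k) //.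
    by rewrite coefB !coefZ coefXn; ring.
  have [_ c1] := cE i; have [c2 _] := cE i.+1; rewrite coefMX /= in c2.
  by rewrite -opprB unitrN -(subrK c`_i (_ - _)); exact: L_local.
(* modulo the maximal ideal, Z l = 'X^(m - l) *)
have claim l : (l <= m)%N -> forall i,
    (Z l)`_i - (i + l == m)%N%:R \isn't a GRing.unit.
  elim: l => [_ i|l IHl lm i]; first by rewrite addn0.
  have [_ /(_ i) s1] := step l (ltnW lm).
  by rewrite -(subrKA (Z l)`_i.+1) addnS -addSn; apply: L_local => //; exact/IHl/ltnW.
(* The last link of the chain makes the constant term of Z_m a nonunit, whereas Z_m = 1 modulo m. *)
have [Z0 _] := step m (ltnSn m).
have := claim m (leqnn m) 0%N; rewrite add0n eqxx => /(nonunitB Z0).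
by rewrite opprB addrC subrK unitr1.
Qed.

(** If m = Lx + m^2 for some x in m, T-nilpotency replaces Nakayama's lemma and gives m = Lx.
    Otherwise two elements of m are independent modulo m^2. *)
Lemma maximal_ideal_principal : exists2 x : L, x \isn't a GRing.unit &
  forall y, y \isn't a GRing.unit -> exists t, y = t * x.
Proof.
have [[x xU xE]|/forall2NP indep] :=
    pselect (exists2 x : L, x \isn't a GRing.unit &
      forall y, y \isn't a GRing.unit -> exists t, nonunit_sq (y - t * x)).
  exists x => // y yU; apply: contrapT => yx.
  pose Q z := exists t, z = t * x.
  (* That is, r m is not inside Lx. As m = Lx + m^2, some product r u v with u, v in m then lies
     outside Lx, so r u is bad again. Iterating from 1 gives bad products of nonunits, one of which
     is 0. *)
  pose bad r := exists2 p, p \isn't a GRing.unit & ~ Q (r * p).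
  have QD a c : Q a -> Q c -> Q (a + c).
    by move=> [s ->] [t ->]; exists (s + t); rewrite mulrDl.
  have bad_step r : exists q, q \isn't a GRing.unit /\ (bad r -> bad (r * q)).
    apply: contrapT => /forallNP no_q.
    have [[p pU rp] rq] : bad r /\ forall q, q \isn't a GRing.unit -> ~ bad (r * q).
      split=> [|q qU bq]; last by apply: (no_q q).
      by apply: contrapT => nb; apply: (no_q 0); rewrite unitr0.
    apply: rp; have [t sq] := xE p pU.
    rewrite -(subrK (t * x) p) mulrDr; apply: (QD); last by exists (r * t); rewrite mulrA.
    elim: sq => [|u v w uU vU _ IHw]; first by exists 0; rewrite mulr0 mul0r.
    rewrite mulrDr; apply: (QD) => //; apply: contrapT => nQ.
    by apply: (rq u uU); exists v => //; rewrite -mulrA.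
  have [q qP] := choice bad_step.
  pose r := fix r n := if n is n'.+1 then r n' * q (r n') else 1.
  have [|n n0] := T_nilpotent L_local L_ess (q := fun n => q (r n)).
    by move=> n; have [] := qP (r n).
  have rE k : \prod_(i < k) q (r i) = r k.
    by elim: k => [|k IHk]; rewrite ?big_ord0 // big_ord_recr /= IHk.
  have bad_r k : bad (r k).
    elim: k => [|k IHk]; first by exists y => //; rewrite mul1r.
    by have [_] := qP (r k); apply.
  have [p _ []] := bad_r n; rewrite -rE n0 mul0r.
  by exists 0; rewrite mul0r.
(* Applied to 0 this gives x outside m^2, and then y outside Lx + m^2. *)
have far (x : L) : x \isn't a GRing.unit -> exists2 y, y \isn't a GRing.unit &
    forall t, ~ nonunit_sq (y - t * x).
  move=> xU; apply: contrapT => no_y; have [] := indep x => // nall.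
  apply: nall => y yU; apply: contrapT => /forallNP yt.
  by apply: no_y; exists y.
have [|x xU x0] := far 0; first by rewrite unitr0.
have [y yU yx] := far x xU.
exfalso; apply: (dependent_mod_sq xU yU) => s t st.
have tU : t \isn't a GRing.unit.
  apply/negP => tU; apply: (yx (- (t^-1 * s))).
  rewrite (_ : _ - _ = t^-1 * (s * x + t * y)); first exact: nonunit_sqM.
  by rewrite mulrDr !mulrA mulVr // mul1r mulNr opprK addrC.
split=> //; apply/negP => sU; apply: (x0 0).
rewrite (_ : _ - _ = s^-1 * (s * x + t * y - t * y)).
  apply/nonunit_sqM/nonunit_sqD => //; rewrite -mulNr.
  by apply: nonunit_sq_mul; rewrite ?unitrN.
by rewrite addrK mulrA mulVr // mul1r mul0r subr0.
Qed.

Lemma maximal_ideal_generator : exists (x : L) n, x ^+ n = 0 /\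
  forall y, y \isn't a GRing.unit -> exists t, y = t * x.
Proof.
have [x xU xE] := maximal_ideal_principal.
have [//|n xn] := T_nilpotent L_local L_ess (q := fun=> x).
by exists x, n; rewrite -xn big_const_ord -Monoid.iteropE.
Qed.

(** By induction on k, c lies in A once x^k c does. The induction hypothesis puts x c into A, and
    purity gives x c = x f z. If c - f z is nonzero, it has a nonzero multiple in A; the multiplier
    is not in m = (x), which kills c - f z, so it is a unit. *)
Lemma pure_essential_surj (A C : lmodType L) (f : {linear A -> C}) :
  eq_pure f ->
  (forall c, c != 0 -> exists l a, l *: c = f a /\ l *: c != 0) ->
  forall c, exists a, f a = c.
Proof.
move=> f_pure f_ess; have [x [n [xn0 xE]]] := maximal_ideal_generator.
have im k : forall c a, f a = x ^+ k *: c -> exists a', f a' = c.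
  elim: k => [|k IHk] c a ac; first by exists a; rewrite ac scale1r.
  have [|d dxc] := IHk (x *: c) a; first by rewrite scalerA -exprSr.
  have [i|z /(_ ord0)] := f_pure 1%N 1%N (fun _ _ => x) (fun=> d) (fun=> c).
    by rewrite big_ord1.
  rewrite big_ord1; move: (z ord0) => {}z dz.
  have [cz|/f_ess[l [e [le l0]]]] := eqVneq (c - f z) 0.
    by exists z; apply/esym/eqP; rewrite -subr_eq0 cz.
  have [lU|/xE[t lt]] := boolP (l \is a GRing.unit).
    exists (l^-1 *: e + z); rewrite linearD linearZ_LR -le scalerA mulVr //.
    by rewrite scale1r subrK.
  case/eqP: l0; rewrite lt -scalerA scalerBr -dxc -linearZ -dz subrr.
  by rewrite scaler0.
by move=> c; apply: (im n c 0); rewrite xn0 scale0r raddf0.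
Qed.

Lemma essential_quotients_pure_semisimple : pure_semisimple L.
Proof.
move=> M A B f /pure_eq_pure f_pure h.
pose N (u : (B * M)%type) := exists a, u = (f a, - h a).
have [|_ _ [a ->] [a' ->]|l _ [a ->]|D [p [p_surj pK]]] :=
    @quotient_exists L (B * M)%type N.
- by exists 0; rewrite !raddf0.
- by exists (a + a'); rewrite !raddfD.
- by exists (l *: a); rewrite !linearZ.
pose j (m : M) := p (0, m).
have j_linear : linear j.
  by move=> l u v; rewrite /j -linearP; congr (p (_, _)); rewrite /= scaler0 addr0.
pose J : {linear M -> D} := HB.pack j (GRing.isLinear.Build L M D *:%R j j_linear).
have J_pure : eq_pure J.
  (* Lift the solution to B x M. The B-components exhibit the errors [d] as a system solvable in B,
     hence in A by some [x]; subtracting h x corrects the M-components. *)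
  move=> m n c a z az; have [Z ZE] := choice (fun k => p_surj (z k)).
  have /choice[d dE] i : exists d : A,
      (0, a i) - \sum_k c i k *: Z k = (f d, - h d).
    apply/pK; rewrite raddfB raddf_sum /=; apply/eqP; rewrite subr_eq0; apply/eqP.
    by rewrite [LHS]az; apply: eq_bigr => k _; rewrite linearZ /= ZE.
  have d1 i : - \sum_k c i k *: (Z k).1 = f (d i).
    have := congr1 fst (dE i); rewrite /= sub0r => <-.
    by rewrite [in RHS]raddf_sum.
  have d2 i : a i - \sum_k c i k *: (Z k).2 = - h (d i).
    by have := congr1 snd (dE i) => /= <-; rewrite [in RHS]raddf_sum.
  have [i|x xE] := f_pure _ _ c d (fun k => - (Z k).1).
    by rewrite -d1 -sumrN; apply: eq_bigr => k _; rewrite scalerN.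
  exists (fun k => (Z k).2 - h (x k)) => i.
  have hd : h (d i) = \sum_k c i k *: h (x k).
    by rewrite xE raddf_sum; apply: eq_bigr => k _; exact: linearZ.
  rewrite -[LHS](subrK (\sum_k c i k *: (Z k).2)) d2 addrC hd -sumrB.
  by apply: eq_bigr => k _; rewrite scalerBr.
have [C [g [gJ_pure gJ_ess]]] := L_ess J_pure.
have gJ_surj := pure_essential_surj gJ_pure gJ_ess.
(* As g J is bijective, [h'] is its inverse applied to the image of B. It extends [h] because (f a,
   0) and (0, h a) differ by (f a, - h a). *)
have [h' h'E] := choice (fun b => gJ_surj (g (p (b, 0)))).
have gJ_inj := eq_pure_inj gJ_pure.
have h'_linear : linear h'.
  move=> l u v; apply: gJ_inj; rewrite linearP !h'E -!linearP.
  by congr (g (p (_, _))); rewrite /= scaler0 addr0.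
pose H : {linear B -> M} :=
  HB.pack h' (GRing.isLinear.Build L B M *:%R h' h'_linear).
exists H => a /=.
apply: gJ_inj; rewrite h'E /= /j; congr (g _).
apply/eqP; rewrite -subr_eq0 -raddfB; apply/eqP/pK; exists a.
by congr (_, _); rewrite /= ?subr0 ?sub0r.
Qed.

End MaximalIdeal.

Theorem theorem3p3 (R : comNzRingType)
  (HR : forall (A B : lmodType R) (f : {linear A -> B}),
          pure_essential f -> essential f)
  (P : {pred R}) (HP : maximal_ideal P)
  (L : comUnitRingType) (phi : {rmorphism R -> L})
  (HL : is_localization P phi) :
  pure_semisimple L.
Proof.
apply: essential_quotients_pure_semisimple => [a b|A D f].
  exact: (localization_local HP HL).
exact: (essential_quotient HP HL HR).
Qed.
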